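(* Let $i, j \geq 0$ be integers and let $\Gamma$ be a graph. Then the graph monoid $M(\Gamma)$ has a submonoid isomorphic to a direct product of $i$ free monoids of rank $1$ and $j$ non-abelian free monoids (that is, to such a product for some choice of $j$ non-abelian free monoids) if and only if $\overline{E_{i,j}}$ embeds in $\Gamma$.
   Context: A graph $\Gamma$ is a set $V(\Gamma)$ of vertices together with a reflexive, symmetric relation $E(\Gamma) \subseteq V(\Gamma) \times V(\Gamma)$; vertices $u,v$ are adjacent if $(u,v) \in E(\Gamma)$. The degree of a vertex is the number of vertices adjacent to and distinct from it. An embedding of graphs is a map on vertices which is injective and preserves both adjacency and non-adjacency. The complement $\overline{\Gamma}$ has the same vertex set as $\Gamma$, with two distinct vertices adjacent exactly if they are not adjacent in $\Gamma$. For integers $i,j \geq 0$, $E_{i,j}$ is the unique graph with exactly $i$ vertices of degree $0$ and $2j$ vertices of degree $1$ (and no other vertices). The graph monoid $M(\Gamma)$ is the monoid with presentation $\langle V(\Gamma) \mid ab = ba \text{ for all } (a,b) \in E(\Gamma) \rangle$. *)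

(* Defs.v *)
From HB Require Import structures.
From mathcomp Require Import all_boot.
From mathcomp Require Import boolp classical_sets functions cardinality.

Set Implicit Arguments.
Unset Strict Implicit.
Unset Printing Implicit Defensive.

Local Open Scope group_scope.
Local Open Scope quotient_scope.
Local Open Scope classical_set_scope.
Local Open Scope card_scope.

Definition isomorphic (G H : monoidType) : Prop :=
  exists f : G -> H, monoid_morphism f /\ bijective f.

Definition has_submonoid_iso (M P : monoidType) : Prop :=
  exists (S : pred M) (H : subMonoidType S), isomorphic H P.

Definition abelian_monoid (G : monoidType) : Prop :=
  forall x y : G, commute x y.

Definition direct_prod (I : Type) (M : I -> monoidType) : Type :=
  forall i, M i.

Section DirectProd.
Variables (I : Type) (M : I -> monoidType).
Implicit Types x y z : direct_prod M.

Definition direct_prod_mul x y : direct_prod M := fun i => x i * y i.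
Definition direct_prod_one : direct_prod M := fun i => 1.

Fact direct_prod_mulA : associative direct_prod_mul.
Proof. by move=> x y z; apply: functional_extensionality_dep => i; exact: mulgA. Qed.

Fact direct_prod_mul1 : left_id direct_prod_one direct_prod_mul.
Proof. by move=> x; apply: functional_extensionality_dep => i; exact: mul1g. Qed.

Fact direct_prod_mulr1 : right_id direct_prod_one direct_prod_mul.
Proof. by move=> x; apply: functional_extensionality_dep => i; exact: mulg1. Qed.

HB.instance Definition _ := gen_eqMixin (direct_prod M).
HB.instance Definition _ := gen_choiceMixin (direct_prod M).
HB.instance Definition _ := isMonoid.Build (direct_prod M)
  direct_prod_mulA direct_prod_mul1 direct_prod_mulr1.

End DirectProd.

(** The free monoid on an arbitrary type of generators: words under
    concatenation.  The type of generators is wrapped in [{classic _}] only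
    because [monoidType] inherits from [choiceType]. *)
Definition free_monoid (X : Type) : Type := seq {classic X}.

HB.instance Definition _ (X : Type) := Choice.on (free_monoid X).
HB.instance Definition _ (X : Type) := isMonoid.Build (free_monoid X)
  (@catA {classic X}) (@cat0s {classic X}) (@cats0 {classic X}).

Definition letter (X : Type) (x : X) : free_monoid X := [:: (x : {classic X})].

Section Presentation.
Variables (X : Type) (R : free_monoid X -> free_monoid X -> Prop).

(** The smallest monoid congruence on words that contains [R]. *)
Inductive generated_congruence : free_monoid X -> free_monoid X -> Prop :=
| gc_rel u v : R u v -> generated_congruence u v
| gc_refl u : generated_congruence u u
| gc_sym u v : generated_congruence u v -> generated_congruence v u
| gc_trans u v w : generated_congruence u v -> generated_congruence v w ->
    generated_congruence u w
| gc_mul u u' v v' : generated_congruence u u' -> generated_congruence v v' ->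
    generated_congruence (u * v) (u' * v').

Definition generated_congruenceb : rel (free_monoid X) :=
  fun u v => `[< generated_congruence u v >].

Fact generated_congruence_equiv : equiv_class_of generated_congruenceb.
Proof.
split=> [u|u v|v u w]; first by apply/asboolP; exact: gc_refl.
- by apply/asboolP/asboolP; exact: gc_sym.
- by move=> /asboolP uv /asboolP vw; apply/asboolP; exact: gc_trans uv vw.
Qed.

Canonical generated_congruence_equiv_rel :=
  EquivRelPack generated_congruence_equiv.

(** The monoid with presentation < X | u = v for all u, v with R u v >. *)
Definition presented_monoid : Type := {eq_quot generated_congruence_equiv_rel}.

HB.instance Definition _ := Choice.on presented_monoid.
HB.instance Definition _ := Quotient.on presented_monoid.

Lemma presented_monoid_eqP (u v : free_monoid X) :
  \pi_presented_monoid u = \pi_presented_monoid v <-> generated_congruence u v.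
Proof. by split=> [/eqmodP/asboolP //|uv]; apply/eqmodP/asboolP. Qed.

Definition presented_mul (x y : presented_monoid) : presented_monoid :=
  \pi_presented_monoid (repr x * repr y).
Definition presented_one : presented_monoid := \pi_presented_monoid (1 : free_monoid X).

Lemma presented_mul_pi (u v : free_monoid X) :
  presented_mul (\pi u) (\pi v) = \pi_presented_monoid (u * v).
Proof.
by apply/presented_monoid_eqP/gc_mul; apply/presented_monoid_eqP; rewrite reprK.
Qed.

Fact presented_mulA : associative presented_mul.
Proof.
move=> x y z; rewrite -[x]reprK -[y]reprK -[z]reprK.
by rewrite !presented_mul_pi mulgA.
Qed.

Fact presented_mul1 : left_id presented_one presented_mul.
Proof. by move=> x; rewrite -[x]reprK presented_mul_pi mul1g. Qed.

Fact presented_mulr1 : right_id presented_one presented_mul.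
Proof. by move=> x; rewrite -[x]reprK presented_mul_pi mulg1. Qed.

HB.instance Definition _ := isMonoid.Build presented_monoid
  presented_mulA presented_mul1 presented_mulr1.

End Presentation.

Record graph := Graph {
  vertex :> Type;
  adj : vertex -> vertex -> Prop;
  adj_refl : forall u, adj u u;
  adj_sym : forall u v, adj u v -> adj v u }.

Definition graph_embedding (G H : graph) (f : G -> H) : Prop :=
  injective f /\ forall u v, adj u v <-> adj (f u) (f v).

Definition embeds (G H : graph) : Prop :=
  exists f : G -> H, graph_embedding f.

Section Complement.
Variable G : graph.

Definition compl_adj (u v : G) : Prop := u = v \/ ~ adj u v.

Fact compl_adj_refl u : compl_adj u u.
Proof. by left. Qed.

Fact compl_adj_sym u v : compl_adj u v -> compl_adj v u.
Proof. by case=> [->|uv]; [left|right=> /adj_sym]. Qed.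

Definition complement : graph := Graph compl_adj_refl compl_adj_sym.

End Complement.

Definition has_degree (G : graph) (u : G) (n : nat) : Prop :=
  [set v : G | adj u v /\ v <> u] #= `I_n.

Section EGraph.
Variables i j : nat.

Definition E_adj (x y : 'I_i + 'I_j * bool) : Prop :=
  match x, y with
  | inl a, inl b => a = b
  | inr p, inr q => p.1 = q.1
  | _, _ => False
  end.

Fact E_adj_refl x : E_adj x x.
Proof. by case: x. Qed.

Fact E_adj_sym x y : E_adj x y -> E_adj y x.
Proof. by case: x y => [a|p] [b|q] /=. Qed.

(** [i] isolated vertices [inl a] and [j] disjoint edges
    [inr (k, false)] -- [inr (k, true)]. *)
Definition E_graph : graph := Graph E_adj_refl E_adj_sym.

End EGraph.

Definition graph_isomorphic (G H : graph) : Prop :=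
  exists f : G -> H, bijective f /\ forall u v, adj u v <-> adj (f u) (f v).

(** [i] vertices of degree 0, [2 * j] of degree 1, no others: this determines
    the graph up to isomorphism, see [E_graph_is_E] and [E_graph_unique]. *)
Definition is_E (i j : nat) (G : graph) : Prop :=
  [/\ forall u : G, has_degree u 0 \/ has_degree u 1,
      [set u : G | has_degree u 0] #= `I_i &
      [set u : G | has_degree u 1] #= `I_(2 * j)%N].

Lemma card_ordP (T : Type) (A : set T) (n : nat) :
  A #= `I_n <-> exists f : 'I_n -> T, injective f /\ range f = A.
Proof.
rewrite (card_eqr card_II) card_eq_sym; split.
  move=> /card_bijP[f [g fK gK]].
  exists (fun k => val (f (SigSub (mem_setT k)))); split.
    move=> k l /val_inj /(can_inj fK) /(congr1 val) //.
  apply/seteqP; split=> [_ [k _ <-]|x Ax]; first exact: set_valP.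
  exists (val (g (SigSub (mem_set Ax)))) => //.
  rewrite (_ : SigSub _ = g (SigSub (mem_set Ax))) ?gK //.
  exact: val_inj.
by move=> [f [f_inj <-]]; rewrite card_eq_sym; apply: inj_card_eq => ? ? _ _ /f_inj.
Qed.

Lemma has_degree_inj (G : graph) (u : G) m n :
  has_degree u m -> has_degree u n -> m = n.
Proof.
rewrite /has_degree => um un; apply/(@card_eq_II m n).
by rewrite -(card_eql um).
Qed.

Lemma has_degree0P (G : graph) (u : G) :
  has_degree u 0 <-> forall v, adj u v -> v = u.
Proof.
split=> [/card_ordP[f [_ fE]] v uv|u0].
  apply: contrapT => vu; have [] : range f v by rewrite fE.
  by case.
apply/card_ordP; exists (fun k : 'I_0 => u); split; first by case.
apply/seteqP; split=> [_ [[]//]|v /= [uv vu]].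
by case: vu; exact: u0.
Qed.

Lemma has_degree1P (G : graph) (u : G) :
  has_degree u 1 <->
  exists v, [/\ adj u v, v <> u & forall w, adj u w -> w = u \/ w = v].
Proof.
split=> [/card_ordP[f [_ fE]]|[v [uv vu uE]]].
  have [ufv fvu] : [set v | adj u v /\ v <> u] (f ord0) by rewrite -fE; exists ord0.
  exists (f ord0); split=> // w uw.
  have [->|wu] := pselect (w = u); first by left.
  right; have [k _ <-] : range f w by rewrite fE.
  by rewrite ord1.
apply/card_ordP; exists (fun k : 'I_1 => v); split; first by move=> k l; rewrite !ord1.
apply/seteqP; split=> [_ [_ _ <-]//|w /= [uw wu]].
by exists ord0 => //; case: (uE w uw).
Qed.

Lemma E_graph_is_E (i j : nat) : is_E i j (E_graph i j).
Proof.
have deg0 a : has_degree (inl a : E_graph i j) 0.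
  by apply/has_degree0P => -[b /= ->|].
have deg1 p : has_degree (inr p : E_graph i j) 1.
  case: p => k b; apply/has_degree1P; exists (inr (k, ~~ b)); split=> //.
    by case; case: b.
  by case=> // -[l c] /= <-; case: b c => -[]; [left|right|right|left].
split.
- by case=> [a|p]; [left|right].
- apply/card_ordP; exists inl; split; first by move=> a b [].
  apply/seteqP; split=> [_ [a _ <-]|[a _|p p0]]; [exact: deg0|by exists a|].
  by have := has_degree_inj p0 (deg1 p).
- have cardE : (2 * j)%N = #|{: 'I_j * bool}| by rewrite card_prod card_ord card_bool mulnC.
  rewrite cardE; apply/card_ordP; exists (fun k => inr (enum_val k)); split.
    by move=> k l [/enum_val_inj].
  apply/seteqP; split=> [_ [a _ <-]|[a a1|p _]]; first exact: deg1.
    by have := has_degree_inj a1 (deg0 a).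
  by exists (enum_rank p); rewrite // enum_rankK.
Qed.

Lemma E_graph_unique (i j : nat) (G : graph) :
  is_E i j G -> graph_isomorphic (E_graph i j) G.
Proof.
move=> [deg /card_ordP[g0 [g0_inj g0E]] /card_ordP[g1 [g1_inj g1E]]].
have deg0 a v : adj (g0 a) v -> v = g0 a.
  by move: v; apply/has_degree0P; have : range g0 (g0 a) by []; rewrite g0E.
have deg1 k : has_degree (g1 k) 1 by have : range g1 (g1 k) by []; rewrite g1E.
have g01 a k : g0 a <> g1 k.
  move=> ak; have [v [kv vk _]] := (has_degree1P _).1 (deg1 k).
  by apply: vk; rewrite -ak; apply: deg0; rewrite ak.
have /choice[s sP] : forall k, exists l, [/\ adj (g1 k) (g1 l), l <> k &
    forall v, adj (g1 k) v -> v = g1 k \/ v = g1 l].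
  move=> k; have [v [kv vk kE]] := (has_degree1P _).1 (deg1 k).
  have : has_degree v 1.
    have [/has_degree0P v0|//] := deg v.
    by case: vk; rewrite [RHS]v0//; exact: adj_sym.
  move=> v1; have [l _ lv] : range g1 v by rewrite g1E.
  by exists l; rewrite lv; split=> // lk; apply: vk; rewrite -lv lk.
have sK : involutive s.
  move=> k; have [ksk skk _] := sP k; have [_ _ skE] := sP (s k).
  by case: (skE _ (adj_sym ksk)) => /g1_inj e; [case: skk|].
pose R := [set k : 'I_(2 * j) | (k < s k)%N]%SET.
have cardR : #|R| = j.
  have sR : (~: R = s @: R)%SET.
    apply/setP => k; rewrite !inE -leqNgt; apply/idP/imsetP.
      move=> kk; exists (s k); rewrite ?sK // inE sK ltn_neqAle kk andbT.
      by apply/eqP => /val_inj; case: (sP k).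
    by move=> [l]; rewrite inE => lsl ->; rewrite sK ltnW.
  have := cardsC R; rewrite sR (card_imset _ (inv_inj sK)) addnn card_ord.
  by rewrite [in RHS]mul2n => /double_inj.
pose h (k : 'I_j) := enum_val (cast_ord (esym cardR) k).
have h_inj : injective h by move=> k l /enum_val_inj /cast_ord_inj.
have hR k : (h k < s (h k))%N by have := enum_valP (cast_ord (esym cardR) k); rewrite inE.
have hs k l : h k <> s (h l).
  move=> e; have := hR k; have := hR l.
  by rewrite {2}e sK e => /ltn_trans/[apply]; rewrite ltnn.
pose p1 (p : 'I_j * bool) := if p.2 then s (h p.1) else h p.1.
have p1_inj : injective p1.
  move=> [k []] [l []]; rewrite /p1 /=.
  - by move=> /(inv_inj sK) /h_inj ->.
  - by move=> /esym /hs.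
  - by move=> /hs.
  - by move=> /h_inj ->.
pose f (x : E_graph i j) : G :=
  match x with inl a => g0 a | inr p => g1 (p1 p) end.
have f_inj : injective f.
  move=> [a|p] [b|q] /=.
  - by move=> /g0_inj ->.
  - by move=> /g01.
  - by move=> /esym /g01.
  - by move=> /g1_inj /p1_inj ->.
have f_surj u : exists x, f x = u.
  have [u0|u1] := deg u.
    have [a _ <-] : range g0 u by rewrite g0E.
    by exists (inl a).
  have [k _ <-] : range g1 u by rewrite g1E.
  have hP l : l \in R -> exists m, h m = l.
    move=> lR; exists (cast_ord cardR (enum_rank_in lR l)).
    by rewrite /h cast_ordK enum_rankK_in.
  have [/hP[m mk]|] := boolP (k \in R).
    by exists (inr (m, false)); rewrite /= /p1 mk.
  rewrite inE -leqNgt => skk.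
  have [|m mk] := hP (s k).
    rewrite inE sK ltn_neqAle skk andbT.
    by apply/eqP => /val_inj; case: (sP k).
  by exists (inr (m, true)); rewrite /= /p1 mk sK.
have sp1 k b : s (p1 (k, b)) = p1 (k, ~~ b) by case: b; rewrite /p1 /= ?sK.
exists f; split.
  by have [g gK] := choice f_surj; exists g => // x; apply: f_inj.
move=> [a|[k b]] [c|[l d]] /=.
- by split=> [->|/deg0/g0_inj ->//]; exact: adj_refl.
- by split=> // /deg0 /esym /g01.
- by split=> // /adj_sym /deg0 /esym /g01.
- have [kk _ kE] := sP (p1 (k, b)); rewrite sp1 in kk kE.
  split=> [<-|/kE[]/g1_inj/p1_inj[]//].
  by have [<-|] := eqVneq b d; [exact: adj_refl|case: b d kk {kE} => -[] //].
Qed.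

Definition commutation (G : graph) (u v : free_monoid G) : Prop :=
  exists a b : G, [/\ adj a b, u = letter a * letter b & v = letter b * letter a].

Definition graph_monoid (G : graph) : monoidType :=
  presented_monoid (@commutation G).

(* Main.v *)
(** A trace is determined by its projections to the free monoids on two
    non-adjacent (or equal) letters, and commuting words of a free monoid are
    powers of a common word.  If [y_k] and [z_k] do not commute, then neither do
    their projections to some non-adjacent letters [b_k], [c_k]; a trace that
    commutes with both then contains neither letter.  The free commutative part
    provides a clique: non-adjacent letters have proportional counts in
    commuting traces, while the matrix of letter counts of the [i] free
    generators has rank [i].  Letters occurring in commuting traces are
    adjacent as soon as one of them is missing from the other trace, which
    gives all remaining adjacencies.  Conversely, in the submonoid generated by
    a copy of the complement of [E_{i,j}], each factor is recovered by erasing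
    all letters but those of that factor. *)

Require Import Defs.
From HB Require Import structures.
From mathcomp Require Import all_boot all_order all_algebra.
From mathcomp Require Import boolp.

Set Implicit Arguments.
Unset Strict Implicit.
Unset Printing Implicit Defensive.

Import GRing.Theory Num.Theory.

Local Open Scope group_scope.
Local Open Scope quotient_scope.

(** * Commutation in free monoids *)

Lemma commute_eq_size (X : Type) (u v : free_monoid X) :
  commute u v -> size u = size v -> u = v.
Proof.
by move=> /eqP + suv; rewrite eqseq_cat// => /andP[/eqP].
Qed.

Lemma size_expg (X : Type) (u : free_monoid X) n : size (u ^+ n) = (n * size u)%N.
Proof. by elim: n => [//|n IH]; rewrite expgS size_cat IH mulSn. Qed.

(** A common power stands in for the common root of commuting words. *)
Lemma commute_expg_size (X : Type) (u v : free_monoid X) :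
  commute u v -> u ^+ size v = v ^+ size u.
Proof.
move=> uv; apply: commute_eq_size; first exact: commuteX2.
by rewrite !size_expg mulnC.
Qed.

Lemma commute_count (X : Type) (a : pred {classic X}) (u v : free_monoid X) :
  commute u v -> (size v * count a u = size u * count a v)%N.
Proof.
have countX w n : count a (w ^+ n : free_monoid X) = (n * count a w)%N.
  by elim: n => [//|n IH]; rewrite expgS count_cat IH mulSn.
by move=> /commute_expg_size uv; rewrite -!countX uv.
Qed.

(* Both [u * v] and [v * u] commute with [w], so they have a common power; being
   of equal length, they are equal. *)
Lemma free_commute_trans (X : Type) (u v w : free_monoid X) :
  w <> 1 -> commute w u -> commute w v -> commute u v.
Proof.
move=> w1 wu wv; have uvX : (u * v) ^+ size w = (v * u) ^+ size w.
  rewrite -(commute_expg_size (commuteM wu wv)) -(commute_expg_size (commuteM wv wu)).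
  by rewrite !size_cat addnC.
have [n sw] : exists n, size w = n.+1.
  by case: w w1 {wu wv uvX} => // a w _; exists (size w).
move: uvX; rewrite sw !expgS => /eqP.
by rewrite eqseq_cat ?size_cat 1?addnC// => /andP[/eqP].
Qed.

Lemma all_pred1_commute (X : eqType) (b : X) (u v : seq X) :
  all (pred1 b) (u ++ v) -> u ++ v = v ++ u.
Proof.
rewrite all_cat => /andP[/all_pred1P -> /all_pred1P ->].
by rewrite !cat_nseq /ncons -!iterD addnC.
Qed.

(** Without [a], both words would be powers of [b]. *)
Lemma not_commute_mem (X : eqType) (a b : X) (u v : seq X) :
  all (pred2 a b) (u ++ v) -> u ++ v <> v ++ u -> a \in u ++ v.
Proof.
move=> /allP uvab uv; apply: contrapT => /negP auv; apply: uv.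
apply: (@all_pred1_commute _ b); apply/allP => x xuv.
have /orP[/eqP xa|//] := uvab x xuv.
by rewrite -xa xuv in auv.
Qed.

Lemma count_pred2 (T : eqType) (a b : T) (s : seq T) :
  a != b -> count (pred2 a b) s = (count_mem a s + count_mem b s)%N.
Proof.
move=> ab; rewrite -count_predUI [X in (_ + X)%N](_ : _ = 0%N) ?addn0//.
apply/eqP; rewrite -leqn0 leqNgt -has_count; apply/hasPn => c _ /=.
by apply: contra ab => /andP[/eqP <- /eqP <-].
Qed.

(** A rational kernel vector is cleared of denominators and split into positive and negative parts,
    because exponents in a monoid must be natural numbers. *)
Lemma nat_row_dependence (m n : nat) (C : 'I_m -> 'I_n -> nat) :
  ~~ row_free (\matrix_(k, l) (C k l)%:R : 'M[rat]_(m, n))%R ->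
  exists p q : 'I_m -> nat, ~ p =1 q /\
    forall l, (\sum_k p k * C k l = \sum_k q k * C k l)%N.
Proof.
rewrite -kermx_eq0 => /rowV0Pn[v /sub_kermxP vC v0].
(* [z] is [v] scaled by the product [d] of all denominators; the one at [k] cancels. *)
pose z k := (numq (v ord0 k) * \prod_(l | l != k) denq (v ord0 l))%R.
pose d := (\prod_l denq (v ord0 l))%R.
have d0 : (d%:~R != 0 :> rat)%R by rewrite intr_eq0; apply/prodf_neq0 => l _; exact: denq_neq0.
have zE k : ((z k)%:~R = d%:~R * v ord0 k :> rat)%R.
  have -> : d = (denq (v ord0 k) * \prod_(l | l != k) denq (v ord0 l))%R by exact: bigD1.
  by rewrite !intrM numqE [RHS]mulrC mulrA.
pose p k := if (0 <= z k)%R then `|z k|%N else 0%N.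
pose q k := if (0 <= z k)%R then 0%N else `|z k|%N.
have pqE k : ((p k)%:R - (q k)%:R = d%:~R * v ord0 k :> rat)%R.
  by rewrite -zE /p /q; case: (z k) => r /=; rewrite ?subr0 ?sub0r ?NegzE ?mulrNz.
exists p, q; split=> [pq|l].
  case/eqP: v0; apply/rowP => k; rewrite mxE; apply: (mulfI d0).
  by rewrite mulr0 -pqE pq subrr.
apply/eqP; rewrite -(eqr_nat rat) -subr_eq0 !natr_sum -sumrB.
rewrite (eq_bigr (fun k => d%:~R * (v ord0 k * (C k l)%:R)))%R; last first.
  by move=> k _; rewrite !natrM -mulrBl pqE mulrA.
rewrite -mulr_sumr; have /rowP/(_ l) := vC; rewrite !mxE.
by under eq_bigr do rewrite mxE; move=> ->; rewrite mulr0.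
Qed.

(** * Traces and their projections to free monoids *)

Section GraphMonoid.
Variable G : graph.
Implicit Types (u v w : free_monoid G) (a b : {classic G}) (A : pred {classic G}).

Local Notation congr := (generated_congruence (@commutation G)).

Lemma congr_cat u u' v v' : congr u u' -> congr v v' -> congr (u ++ v) (u' ++ v').
Proof. exact: gc_mul. Qed.

Lemma congr_cons a u v : congr u v -> congr (a :: u) (a :: v).
Proof. exact: (@congr_cat [:: a] [:: a] u v (gc_refl _ _)). Qed.

Lemma congr_cons_commute a u :
  (forall b, b \in u -> adj a b) -> congr (a :: u) (rcons u a).
Proof.
elim: u => [|b u IH] abu; first exact: gc_refl.
apply: (@gc_trans _ _ _ ([:: b; a] ++ u)).
  rewrite -[a :: b :: u]/([:: a; b] ++ u).
  apply: congr_cat (gc_refl _ _); apply: gc_rel; exists a, b; split => //.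
  by apply: abu; rewrite mem_head.
rewrite rcons_cons; apply: congr_cons.
by apply: IH => c cu; apply: abu; rewrite in_cons cu orbT.
Qed.

Lemma congr_commute u v :
  (forall a b, a \in u -> b \in v -> adj a b) -> congr (u ++ v) (v ++ u).
Proof.
elim: u => [|a u IH] uv; first by rewrite cats0; exact: gc_refl.
apply: (@gc_trans _ _ _ (a :: v ++ u)).
  by apply: congr_cons; apply: IH => b c bu; apply: uv; rewrite in_cons bu orbT.
rewrite -cat_rcons -cat_cons; apply: congr_cat (gc_refl _ _).
by apply: congr_cons_commute => b bv; apply: uv; rewrite ?mem_head.
Qed.

(* A set of pairwise non-adjacent letters: erasing all other letters is then a
   morphism from the graph monoid to a free monoid. *)
Definition independent A := forall a b, A a -> A b -> adj a b -> a = b.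

Lemma congr_filter A u v : independent A -> congr u v -> filter A u = filter A v.
Proof.
move=> Aind; elim=> {u v} [_ _ [a [b [ab -> ->]]]|//|//|u v w _ -> _ ->//|].
  rewrite /letter; have [<-//|anb] := pselect (a = b).
  rewrite [LHS]/= [RHS]/=; case: ifP => Aa; case: ifP => Ab //.
  by case: anb; exact: Aind.
by move=> u u' v v' _ uu _ vv; rewrite !filter_cat uu vv.
Qed.

(** This form of the hypothesis also covers [a = b], where filtering records how often one letter
    occurs. *)
Lemma pred2_independent a b : (adj a b -> a = b) -> independent (pred2 a b).
Proof.
move=> abE c d /= /orP[]/eqP-> /orP[]/eqP-> //.
by move=> /adj_sym /abE.
Qed.

(* In [v], every letter [b] before the first occurrence of [a] is adjacent to
   [a]: otherwise [filter (pred2 a b) v] would start with [b]. Hence that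
   occurrence can be moved to the front of [v]. *)
Lemma congr_of_filter u v :
  (forall a b, (adj a b -> a = b) -> filter (pred2 a b) u = filter (pred2 a b) v) ->
  congr u v.
Proof.
elim: u v => [|a u IH] v uv.
  case: v uv => [|b v] uv; first exact: gc_refl.
  by have := uv b b (fun=> erefl); rewrite /= eqxx.
have av : a \in v.
  have := uv a a (fun=> erefl); rewrite /= eqxx /= => /(congr1 (fun s => a \in s)).
  by rewrite mem_head mem_filter => /esym /andP[].
pose v1 := take (index a v) v; pose v2 := drop (index a v).+1 v.
have vE : v = v1 ++ a :: v2.
  by rewrite /v1 /v2 -[X in _ ++ X :: _](nth_index a av) -drop_nth ?index_mem// cat_take_drop.
have av1 : a \notin v1 by rewrite /v1 in_take_leq ?ltnn// index_size.
have v1a b : b \in v1 -> adj a b.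
  move=> bv1; apply: contrapT => nab.
  have := uv a b (fun ab => False_ind _ (nab ab)).
  rewrite vE filter_cat /= eqxx /=.
  have : b \in filter (pred2 a b) v1 by rewrite mem_filter bv1 /= eqxx orbT.
  case E: (filter _ v1) => [//|c s] _ [ca _].
  have : c \in filter (pred2 a b) v1 by rewrite E mem_head.
  by rewrite mem_filter -ca (negbTE av1) andbF.
apply: (@gc_trans _ _ _ (a :: v1 ++ v2)).
  apply: congr_cons.
  apply: IH => b c bc; have := uv b c bc; rewrite vE !filter_cat /=.
  case: ifPn => [abc|_ ->//].
  (* A letter of [v1] kept by this filter is adjacent to [a], hence equal to [a], which does not
     occur in [v1]. *)
  have -> : filter (pred2 b c) v1 = [::]; last by rewrite /= => -[].
  apply/eqP; rewrite -[_ == _]negbK -has_filter; apply/hasPn => d dv1.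
  apply/negP => dbc; have da : d = a.
    by apply: (pred2_independent bc dbc abc); apply: adj_sym; exact: v1a.
  by rewrite -da dv1 in av1.
rewrite vE -cat_cons -cat_rcons.
by apply: congr_cat (gc_refl _ _); exact: congr_cons_commute.
Qed.

(** [repr x] is an arbitrary word for [x]; for independent [A], [proj_pi] shows that the choice does
    not matter. *)
Definition proj A (x : graph_monoid G) : free_monoid G := filter A (repr x).

Lemma proj_pi A u : independent A -> proj A (\pi u : graph_monoid G) = filter A u.
Proof.
move=> Aind; apply: congr_filter => //; apply/presented_monoid_eqP.
by rewrite reprK.
Qed.

Lemma projM A (x y : graph_monoid G) :
  independent A -> proj A (x * y) = proj A x * proj A y.
Proof.
move=> Aind; rewrite -[x in LHS]reprK -[y in LHS]reprK.
by rewrite [_ * _ in LHS]presented_mul_pi proj_pi// filter_cat.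
Qed.

Lemma proj_ext (x y : graph_monoid G) :
  (forall a b, (adj a b -> a = b) -> proj (pred2 a b) x = proj (pred2 a b) y) ->
  x = y.
Proof.
move=> xy; rewrite -[x]reprK -[y]reprK; apply/presented_monoid_eqP.
exact: congr_of_filter.
Qed.

Lemma pi_commute u v : (forall a b, a \in u -> b \in v -> adj a b) ->
  commute (\pi u : graph_monoid G) (\pi v).
Proof.
move=> uv; rewrite /commute [LHS]presented_mul_pi [RHS]presented_mul_pi.
by apply/presented_monoid_eqP/congr_commute.
Qed.

(** * Commuting traces *)

Lemma commute_proj A (x y : graph_monoid G) :
  independent A -> commute x y -> commute (proj A x) (proj A y).
Proof. by move=> Aind xy; rewrite /commute -!projM// xy. Qed.

(** Otherwise the projections to [a] and [b] commute, so their numbers of [b] are proportional to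
    their lengths; but that of [x] is nonempty without [b], and that of [y] contains [b]. *)
Lemma commute_adj (x y : graph_monoid G) a b :
  commute x y -> a \in repr x -> b \in repr y -> b \notin repr x -> adj a b.
Proof.
move=> xy ax bY bx; apply: contrapT => nab.
have abind : independent (pred2 a b) by apply: pred2_independent => /nab.
have := commute_count (pred1 b) (commute_proj abind xy).
have -> : count (pred1 b) (proj (pred2 a b) x) = 0%N.
  by apply/count_memPn; rewrite mem_filter negb_and bx orbT.
rewrite muln0 => /esym/eqP; rewrite muln_eq0 => /orP[/nilP xab|].
  have : a \in proj (pred2 a b) x by rewrite mem_filter /= eqxx ax.
  by rewrite xab.
by move=> /eqP/count_memPn; rewrite mem_filter /= eqxx orbT bY.
Qed.

(** An occurrence of [a] would make the projection of [w] nontrivial, and [free_commute_trans] would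
    apply. *)
Lemma commute_notin A (w y z : graph_monoid G) a :
  independent A -> ~ commute (proj A y) (proj A z) ->
  commute w y -> commute w z -> A a -> a \notin repr w.
Proof.
move=> Aind nyz wy wz Aa; apply/negP => aw; apply: nyz.
apply: (@free_commute_trans _ _ _ (proj A w)); try exact: commute_proj.
move=> w1; have : a \in proj A w by rewrite mem_filter Aa aw.
by rewrite w1.
Qed.

(** * Letter counts and cliques *)

Definition letter_count a (x : graph_monoid G) : nat := count_mem a (repr x).

Lemma pred1_independent a : independent (pred1 a).
Proof. by move=> b c /eqP-> /eqP->. Qed.

Lemma letter_count1 a : letter_count a 1 = 0%N.
Proof.
by rewrite /letter_count -size_filter -/(proj _ _) proj_pi//; exact: pred1_independent.
Qed.

(** The count is the length of the projection to a single letter. *)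
Lemma letter_countM a : {morph letter_count a : x y / x * y >-> (x + y)%N}.
Proof.
move=> x y; rewrite /letter_count -!size_filter -!/(proj _ _) projM ?size_cat//.
exact: pred1_independent.
Qed.

Lemma letter_count_prod (n : nat) (x : 'I_n -> graph_monoid G) (p : 'I_n -> nat) a :
  letter_count a (\prod_m x m ^+ p m) = (\sum_m p m * letter_count a (x m))%N.
Proof.
rewrite (big_morph _ (letter_countM a) (letter_count1 a)); apply: eq_bigr => m _.
elim: (p m) => [|k IH]; first by rewrite letter_count1.
by rewrite expgS letter_countM IH mulSn.
Qed.

(* The projections of [x] and [y] to the free monoid on [a] and [b] commute,
   hence are powers of a common word. *)
Lemma commute_letter_count (x y : graph_monoid G) a b : commute x y -> ~ adj a b ->
  (letter_count b x * letter_count a y = letter_count a x * letter_count b y)%N.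
Proof.
move=> xy nab; have ab : a != b by apply/eqP => ab; apply: nab; rewrite ab; exact: adj_refl.
have abind : independent (pred2 a b) by apply: pred2_independent => /nab.
have countE (w : graph_monoid G) : count (pred1 a) (proj (pred2 a b) w) = letter_count a w.
  rewrite count_filter; apply: eq_count => c /=.
  by case: eqP.
have := commute_count (pred1 a) (commute_proj abind xy).
rewrite !countE !size_filter !count_pred2// -!/(letter_count _ _).
rewrite !mulnDl [X in (X + _ = _)%N -> _]mulnC => /addnI.
by rewrite mulnC => ->.
Qed.

(** Projections to two non-adjacent or equal letters commute and have the same length, so they
    agree. *)
Lemma commute_letter_count_eq (x y : graph_monoid G) :
  commute x y -> (forall a, letter_count a x = letter_count a y) -> x = y.
Proof.
move=> xy cxy; apply: proj_ext => a b ab.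
apply: commute_eq_size; first by apply: commute_proj => //; exact: pred2_independent.
rewrite !size_filter; have [<-|anb] := eqVneq a b; last first.
  by rewrite !count_pred2// -!/(letter_count _ _) !cxy.
rewrite !(@eq_count _ (pred2 a a) (pred1 a)) -?/(letter_count _ _) ?cxy// => c /=;
  by rewrite orbb.
Qed.

(** Contrapositive of [proj_ext] for [x * y] and [y * x]. *)
Lemma not_commute_proj (x y : graph_monoid G) : ~ commute x y ->
  exists a b, (adj a b -> a = b) /\
    ~ commute (proj (pred2 a b) x) (proj (pred2 a b) y).
Proof.
move=> nxy; apply: contrapT => nab; apply: nxy; apply: proj_ext => a b ab.
have abind := pred2_independent ab; rewrite !projM//.
by apply: contrapT => nc; apply: nab; exists a, b.
Qed.

(* Freeness makes the matrix of letter counts of rank [n]: a linear dependence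
   would give two distinct products with the same counts. The rows of
   non-adjacent letters are proportional, so [n] independent ones are a clique. *)
Lemma exists_clique (n : nat) (x : 'I_n -> graph_monoid G) :
  (forall k l, commute (x k) (x l)) ->
  (forall p q : 'I_n -> nat, \prod_k x k ^+ p k = \prod_k x k ^+ q k -> p =1 q) ->
  exists a : 'I_n -> {classic G}, [/\ injective a,
    forall k l, adj (a k) (a l) & forall k, exists m, a k \in repr (x m)].
Proof.
move=> xC xfree.
(* [G] may be infinite; only the finitely many letters occurring in some [x m] index the matrix. *)
pose W := undup (flatten [seq (repr (x m) : seq {classic G}) | m <- enum 'I_n]).
pose lt := tnth (in_tuple W).
have lt_inj : injective lt by apply/tuple_uniqP; exact: undup_uniq.
have lt_mem l : exists m, lt l \in repr (x m).
  have := mem_tnth l (in_tuple W); rewrite mem_undup => /flatten_mapP[m _ lm].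
  by exists m.
have mem_lt m a : a \in repr (x m) -> exists l, lt l = a.
  move=> am; have /tnthP[l ->] : a \in in_tuple W; last by exists l.
  by rewrite mem_undup; apply/flatten_mapP; exists m; rewrite ?mem_enum.
pose C m l := letter_count (lt l) (x m).
pose M : 'M[rat]_(n, size W) := (\matrix_(k, l) (C k l)%:R)%R.
have Mfree : row_free M.
  apply: contrapT => /negP /nat_row_dependence[p [q [npq pq]]]; apply: npq.
  apply: xfree; apply: commute_letter_count_eq.
    apply: commute_prod => k _; apply/commute_sym/commute_prod => l _.
    exact: commuteX2.
  move=> a; rewrite !letter_count_prod.
  have [[m am]|na] := pselect (exists m, a \in repr (x m)).
    by have [l <-] := mem_lt m a am; exact: pq.
  rewrite !big1// => m _; rewrite [letter_count _ _](count_memPn _) ?muln0//;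
    by apply/negP => am; apply: na; exists m.
have Mfull : row_full (M^T)%R by rewrite /row_full mxrank_tr.
pose f := fullrankfun Mfull; pose a k := lt (f k).
exists a; split=> [k l /lt_inj /fullrankfun_inj//|k l|k]; last exact: lt_mem.
apply: contrapT => nkl; have kl : k != l.
  by apply/eqP => kl; apply: nkl; rewrite kl; exact: adj_refl.
have Dfree : row_free (rowsub f (M^T)%R) by rewrite row_free_unit fullrowsub_unit.
have [m km] := lt_mem (f k).
(* This combination of two rows of an invertible matrix vanishes by [commute_letter_count], yet its
   coefficient at [l] is nonzero since [a k] occurs in [x m]. *)
have : ((letter_count (a l) (x m))%:R *: delta_mx ord0 k
        - (letter_count (a k) (x m))%:R *: delta_mx ord0 l : 'rV[rat]_n)%R == 0%R.
  rewrite -(mulmx_free_eq0 _ Dfree); apply/eqP/rowP => r.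
  rewrite mulmxBl -!scalemxAl -!rowE !mxE -!natrM.
  by rewrite (@commute_letter_count _ _ (a k) (a l))// subrr.
move=> /eqP/rowP/(_ l); rewrite !mxE eqxx [l == k]eq_sym (negbTE kl) mulr0 mulr1 sub0r.
move=> /eqP; rewrite oppr_eq0 pnatr_eq0 => /eqP/count_memPn.
by rewrite km.
Qed.


(** * The embedding obtained from commuting traces *)

(** The [x k] stand for the generators of the rank-one factors, [y k] and [z k] for a non-commuting
    pair in the [k]-th non-abelian factor. *)
Lemma embeds_of_commuting (i j : nat) (x : 'I_i -> graph_monoid G)
    (y z : 'I_j -> graph_monoid G) :
  (forall k l, commute (x k) (x l)) ->
  (forall p q : 'I_i -> nat, \prod_k x k ^+ p k = \prod_k x k ^+ q k -> p =1 q) ->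
  (forall k l, commute (x k) (y l) /\ commute (x k) (z l)) ->
  (forall k l, k <> l ->
     [/\ commute (y k) (y l), commute (y k) (z l) & commute (z k) (z l)]) ->
  (forall k, ~ commute (y k) (z k)) ->
  embeds (complement (E_graph i j)) G.
Proof.
move=> xC xfree xyz yzC nyz.
have [a [a_inj aC ax]] := exists_clique xC xfree.
have /choice[b bP] k : exists b : bool -> {classic G},
    (adj (b false) (b true) -> b false = b true) /\
    ~ commute (proj (pred2 (b false) (b true)) (y k))
              (proj (pred2 (b false) (b true)) (z k)).
  have [c [d [cd ncd]]] := not_commute_proj (nyz k).
  by exists (fun s => if s then d else c).
have bind k : independent (pred2 (b k false) (b k true)).
  by apply: pred2_independent; case: (bP k).
have bb k s : pred2 (b k false) (b k true) (b k s).
  by case: s; rewrite /= eqxx ?orbT.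
have b_notin (w : graph_monoid G) k s :
    commute w (y k) -> commute w (z k) -> b k s \notin repr w.
  move=> wy wz; have [_ nc] := bP k.
  exact: (commute_notin (bind k) nc wy wz (bb k s)).
(* A single trace containing both letters [b k s] and commuting with everything outside the [k]-th
   pair. *)
pose t k := y k * z k.
have bt k s : b k s \in repr (t k).
  have [_ nc] := bP k.
  suff : b k s \in proj (pred2 (b k false) (b k true)) (t k).
    by rewrite mem_filter => /andP[].
  rewrite /t projM//; case: s; last first.
    apply: (not_commute_mem _ nc).
    by rewrite all_cat; apply/andP; split; exact: filter_all.
  apply: (@not_commute_mem _ _ (b k false) _ _ _ nc).
  rewrite all_cat; apply/andP; split; apply/allP => c;
    by rewrite mem_filter /= orbC => /andP[].
have bF k : b k false <> b k true.
  have [_ nc] := bP k => ab; apply: nc; rewrite ab.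
  apply: (@all_pred1_commute _ (b k true)
    (proj (pred2 (b k true) (b k true)) (y k))
    (proj (pred2 (b k true) (b k true)) (z k))).
  by rewrite all_cat; apply/andP; split; apply/allP => c;
    rewrite mem_filter /= orbb => /andP[].
have tb k l s : k <> l -> b l s \notin repr (t k).
  move=> kl; have [yy yz zz] := yzC k l kl.
  have [_ lyz _] := yzC l k (nesym kl).
  by apply: b_notin; apply/commute_sym/commuteM; apply: commute_sym.
have xb k l s : b l s \notin repr (x k) by case: (xyz k l) => *; exact: b_notin.
have ab_adj k l s : adj (a k) (b l s).
  have [m am] := ax k; have [xy xz] := xyz m l.
  exact: commute_adj (commuteM xy xz) am (bt l s) (xb m l s).
have ab_neq k l s : a k <> b l s.
  by have [m am] := ax k => akl; have := xb m l s; rewrite -akl am.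
have bb_adj k l s r : k <> l -> adj (b k s) (b l r).
  move=> kl; have [yy yz zz] := yzC k l kl.
  have [_ lyz _] := yzC l k (nesym kl).
  apply: (@commute_adj (t k) (t l)); rewrite ?bt ?tb//.
  by apply: commuteM; apply/commute_sym/commuteM => //; apply: commute_sym.
have bb_eq k l s r : b k s = b l r -> (k, s) = (l, r).
  move=> kl; have [kEl|nkl] := pselect (k = l); last first.
    by have := tb k l r nkl; rewrite -kl bt.
  by rewrite -kEl in kl *; case: s r kl => -[] // => [/esym|] /bF.
exists (fun u : complement (E_graph i j) =>
  match u with inl k => a k | inr (k, s) => b k s end);
  split.
  move=> [k|[k s]] [l|[l r]].
  - by move=> /a_inj ->.
  - by move=> /ab_neq.
  - by move=> /esym /ab_neq.
  - by move=> /bb_eq ->.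
move=> [k|[k s]] [l|[l r]]; rewrite /= /compl_adj /=; split => //.
- move=> _; have [->|kl] := pselect (k = l); first by left.
  by right.
- by right.
- by move=> _; apply: adj_sym; exact: ab_adj.
- by right.
- case=> [[<- <-]|]; [exact: adj_refl|exact: bb_adj].
(* Within one pair, adjacency would force the two letters to be equal, against [bF]. *)
- have [<-|kl] := pselect (k = l); last by right.
  move=> sr; left; congr (inr (_, _)); have [bE _] := bP k.
  case: s r sr => -[] //; last by move=> /bE /bF.
  by move=> /adj_sym /bE /bF.
Qed.

End GraphMonoid.

(** * Submonoids as images of injective morphisms *)

Lemma has_submonoid_isoP (M P : monoidType) :
  has_submonoid_iso M P <->
  exists h : P -> M, monoid.monoid_morphism h /\ injective h.
Proof.
split=> [[S [H [f [[f1 fM] [g fK gK]]]]]|[h [[h1 hM] h_inj]]].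
  exists (\val \o g); split; last by apply: inj_comp (can_inj gK); exact: val_inj.
  split=> [|p q] /=; first by rewrite -f1 fK val1.
  by rewrite -valM -[p in LHS]gK -[q in LHS]gK -fM fK.
(* The submonoid is the image of [h], and the isomorphism is the inverse of [h]. *)
pose S : pred M := fun x => `[< exists p, h p = x >].
have S_closed : monoid_closed S.
  split=> [|_ _ /asboolP[p <-] /asboolP[q <-]]; apply/asboolP.
    by exists 1.
  by exists (p * q); rewrite hM.
pose H := {x : M | S x}.
pose HM := SubChoice_isSubMonoid.Build M S H S_closed.
pose HMon : subMonoidType S := HB.pack H HM.
exists S, HMon.
have hS p : S (h p) by apply/asboolP; exists p.
have /choice[f fP] (u : HMon) : exists p, h p = val u by have /asboolP := valP u.
exists f; split.
  split; first by apply: h_inj; rewrite fP h1 val1.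
  by move=> u v; apply: h_inj; rewrite hM !fP valM.
exists (fun p => Sub (h p) (hS p)) => [u|p]; last by apply: h_inj; rewrite fP SubK.
by apply: val_inj; rewrite SubK fP.
Qed.

(** Each [H c] moves past the later [F d]; as [r] has no repetition, it never has to pass [F c]. *)
Lemma prod_commuteM (M : monoidType) (I : eqType) (r : seq I) (F H : I -> M) :
  uniq r -> (forall c d, c != d -> commute (F c) (H d)) ->
  \prod_(c <- r) (F c * H c) = \prod_(c <- r) F c * \prod_(c <- r) H c.
Proof.
move=> + FH; elim: r => [|c r IH] /=; first by rewrite !big_nil mulg1.
move=> /andP[cr /IH rE]; rewrite !big_cons rE -!mulgA; congr (_ * _).
rewrite !mulgA; congr (_ * _); apply: commute_sym.
rewrite big_seq; apply/commute_sym.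
have : commute (H c) (\prod_(d <- r | d \in r) F d); last by [].
apply: commute_prod => d dr; apply/commute_sym/FH.
by apply: contraNneq cr => <-.
Qed.

(** * Products of free monoids inside a graph monoid *)

Section LetterwiseMap.
Variables (G : graph) (I : finType) (B : I -> Type) (phi : forall c, B c -> G).
Arguments phi : clear implicits.
Hypothesis phi_adj : forall c d s t, c != d ->
  adj (phi c s) (phi d t) /\ phi c s <> phi d t.
Hypothesis phi_ind : forall c s t, adj (phi c s) (phi c t) -> s = t.

Let word c (w : free_monoid (B c)) : free_monoid G :=
  map (phi c : {classic (B c)} -> {classic G}) w.

Definition letterwise_map (w : direct_prod (fun c => free_monoid (B c))) :
  graph_monoid G := \prod_c \pi_(graph_monoid G) (word (w c)).

Lemma mem_word c w (a : {classic G}) : a \in @word c w -> exists s, a = phi c s.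
Proof. by move=> /mapP[s _ ->]; exists s. Qed.

Lemma letterwise_map_morphism : monoid.monoid_morphism letterwise_map.
Proof.
split; first by rewrite /letterwise_map big1.
move=> w w'; rewrite /letterwise_map -prod_commuteM ?index_enum_uniq//.
  apply: eq_bigr => c _; rewrite [RHS]presented_mul_pi; congr (\pi _).
  exact: map_cat.
move=> c d cd; apply: pi_commute => a b /mem_word[s ->] /mem_word[t ->].
by have [] := phi_adj s t cd.
Qed.

(** The image of [phi c] is independent by [phi_ind] and contains no letter of another factor by
    [phi_adj], so projecting to it returns [word (w c)]. *)
Lemma letterwise_map_inj : injective letterwise_map.
Proof.
move=> w w' ww; apply: functional_extensionality_dep => c.
pose A : pred {classic G} := fun a => `[< exists s, a = phi c s >].
have Aind : independent A.
  by move=> _ _ /asboolP[s ->] /asboolP[t ->] /phi_ind ->.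
have projE v : proj A (letterwise_map v) = word (v c).
  rewrite (big_morph (proj A) (id1 := 1) (op1 := *%g)); first last.
  - by rewrite proj_pi.
  - by move=> ? ?; rewrite projM.
  rewrite (eq_bigr (fun d => if d == c then word (v c) else 1)).
    by rewrite -big_mkcond big_pred1_eq.
  move=> d _; rewrite proj_pi//; case: eqP => [->|/eqP dc].
    apply/all_filterP/allP => a /mem_word[s ->]; apply/asboolP; by exists s.
  apply/eqP; rewrite -[_ == _]negbK -has_filter; apply/hasPn => a /mem_word[s ->].
  by apply/asboolP => -[t]; case: (phi_adj s t dc).
have : word (w c) = word (w' c) by rewrite -!projE ww.
apply: inj_map => s t st; apply: (@phi_ind c); rewrite st; exact: adj_refl.
Qed.

End LetterwiseMap.

(** * From submonoids to embeddings and back *)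

Lemma embeds_of_submonoid (i j : nat) (G : graph) (A : 'I_j -> Type)
    (h : direct_prod (fun _ : 'I_i => free_monoid unit) *
         direct_prod (fun k : 'I_j => free_monoid (A k)) -> graph_monoid G) :
  (forall k, ~ abelian_monoid (free_monoid (A k))) ->
  monoid.monoid_morphism h -> injective h ->
  embeds (complement (E_graph i j)) G.
Proof.
move=> Anab [h1 hM] h_inj.
have uv k : {p : free_monoid (A k) * free_monoid (A k) | ~ commute p.1 p.2}.
  apply: cid; apply: contrapT => nuv; apply: (Anab k) => u v.
  by apply: contrapT => uv; apply: nuv; exists (u, v).
pose u k := (sval (uv k)).1; pose v k := (sval (uv k)).2.
pose N := direct_prod (fun _ : 'I_i => free_monoid unit).
pose F := direct_prod (fun k : 'I_j => free_monoid (A k)).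
(* [e k] generates the [k]-th rank-one factor; [s w k] carries [w k] in coordinate [k] and is
   trivial elsewhere. *)
pose e (k : 'I_i) : N := 
  @dfwith _ (fun=> free_monoid unit) (fun=> 1) k (letter tt).
pose s (w : forall k, free_monoid (A k)) (k : 'I_j) : F :=
  @dfwith _ (fun l => free_monoid (A l)) (fun=> 1) k (w k).
have hC p q : commute p q -> commute (h p) (h q).
  by move=> pq; rewrite /commute -!hM pq.
have sC w w' k l : k <> l -> commute (s w k) (s w' l).
  move=> /eqP kl; apply: functional_extensionality_dep => m.
  change (s w k m * s w' l m = s w' l m * s w k m); rewrite /s.
  have [<-|km] := eqVneq k m; last by rewrite dfwith_out// mul1g mulg1.
  by rewrite [dfwith _ (w' l) k]dfwith_out 1?eq_sym// mul1g mulg1.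
apply: (@embeds_of_commuting G i j (fun k => h (e k, 1 : F))
  (fun k => h (1 : N, s u k)) (fun k => h (1 : N, s v k))).
- move=> k l; apply: hC; congr (_, _); apply: functional_extensionality_dep => m.
  apply: (@all_pred1_commute {classic unit} tt (e k m) (e l m)).
  by apply/allP => -[] _; exact: eqxx.
- have prodE p : \prod_k h (e k, 1 : F) ^+ p k = h (\prod_k (e k, 1 : F) ^+ p k).
    rewrite (big_morph h hM h1); apply: eq_bigr => k _.
    by elim: (p k) => [|n IH]; rewrite ?h1// !expgS IH hM.
  move=> p q; rewrite !prodE => /h_inj pq k.
  (* Exponents are read off as lengths of coordinates. *)
  have kE r : size ((\prod_l ((e l, 1) : N * F) ^+ r l).1 k) = r k.
    pose sz (w : N * F) := size (w.1 k).
    have szM : {morph sz : x y / x * y >-> (x + y)%N}.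
      by move=> x y; rewrite /sz size_cat.
    rewrite -/(sz _) (big_morph sz szM (erefl : sz 1 = 0%N)).
    have szX x n : sz (x ^+ n) = (n * sz x)%N.
      by elim: n => [//|n IH]; rewrite expgS szM IH mulSn.
    rewrite (bigD1 k)//= big1 ?addn0 => [|l lk]; rewrite szX /sz /= /e.
      by rewrite dfwith_in muln1.
    by rewrite dfwith_out// muln0.
  by rewrite -(kE p) -(kE q) pq.
- move=> k l; split; apply: hC; congr (_, _); by rewrite mul1g mulg1.
- by move=> k l kl; split; apply: hC; congr (_, _); exact: sC.
move=> k; rewrite /commute -!hM => /h_inj[] /(congr1 (fun w => w k)).
change (s u k k * s v k k = s v k k * s u k k -> False).
rewrite /s !dfwith_in; exact: svalP (uv k).
Qed.

Lemma submonoid_of_embeds (i j : nat) (G : graph) :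
  embeds (complement (E_graph i j)) G ->
  exists h : direct_prod (fun _ : 'I_i => free_monoid unit) *
             direct_prod (fun _ : 'I_j => free_monoid bool) -> graph_monoid G,
    monoid.monoid_morphism h /\ injective h.
Proof.
move=> [f [f_inj fE]].
(* Both kinds of factors are indexed by one sum type, to fit [letterwise_map]; the two letters of a
   [bool] factor go to the ends of one edge of [E_graph]. *)
pose B (c : 'I_i + 'I_j) : Type := if c is inl _ then unit else bool.
pose phi (c : 'I_i + 'I_j) : B c -> G :=
  match c with
  | inl k => fun _ => f (inl k)
  | inr k => fun s => f (inr (k, s))
  end.
have phi_adj c d s t : c != d -> adj (phi c s) (phi d t) /\ phi c s <> phi d t.
  move=> /eqP cd; case: c d s t cd => [k|k] [l|l] s t cd; split=> /=;
    try (apply/fE; right => //=).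
  - by move=> kl; apply: cd; rewrite kl.
  - by move=> /f_inj [kl]; apply: cd; rewrite kl.
  - by move=> /f_inj.
  - by move=> /f_inj.
  - by move=> kl; apply: cd; rewrite kl.
  - by move=> /f_inj [kl _]; apply: cd; rewrite kl.
have phi_ind c s t : adj (phi c s) (phi c t) -> s = t.
  case: c s t => [k [] []//|k s t] /fE; case=> [[]//|] /=.
  by case.
pose merge (p : direct_prod (fun _ : 'I_i => free_monoid unit) *
    direct_prod (fun _ : 'I_j => free_monoid bool)) :
    direct_prod (fun c => free_monoid (B c)) :=
  fun c => match c with inl k => p.1 k | inr k => p.2 k end.
have [m1 mM] := letterwise_map_morphism phi_adj.
exists (@letterwise_map _ _ _ phi \o merge); split.
  split=> [|p q] /=.
    by rewrite -m1; congr letterwise_map; apply: functional_extensionality_dep; case.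
  by rewrite -mM; congr letterwise_map; apply: functional_extensionality_dep; case.
move=> [p1 p2] [q1 q2] /(letterwise_map_inj phi_adj phi_ind) pq.
congr (_, _); apply: functional_extensionality_dep => k.
  exact: (congr1 (fun w : direct_prod (fun c => free_monoid (B c)) => w (inl k)) pq).
exact: (congr1 (fun w : direct_prod (fun c => free_monoid (B c)) => w (inr k)) pq).
Qed.

Theorem theorem17 (i j : nat) (G : graph) :
  (exists A : 'I_j -> Type,
     (forall k : 'I_j, ~ abelian_monoid (free_monoid (A k))) /\
     has_submonoid_iso (graph_monoid G)
       (direct_prod (fun _ : 'I_i => free_monoid unit) *
        direct_prod (fun k : 'I_j => free_monoid (A k)))%type)
  <-> embeds (complement (E_graph i j)) G.
Proof.
split=> [[A [Anab /has_submonoid_isoP[h [hM h_inj]]]]|/submonoid_of_embeds Gh].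
  exact: embeds_of_submonoid Anab hM h_inj.
exists (fun=> bool); split; last exact/has_submonoid_isoP.
by move=> _ /(_ (letter true) (letter false)).
Qed.
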